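(* Let $\mathcal{A}$ be a unital $C^*$-algebra and let $\mathcal{H}$ be a complex Hilbert space with $\dim(\mathcal{H})<\infty$. Then for every positive operator $P\in\mathscr{B}(\mathcal{H})$, every $P$-$C^*$-extreme point of $\mathrm{CP}^{(P)}(\mathcal{A},\mathscr{B}(\mathcal{H}))$ is a linear extreme point of the convex set $\mathrm{CP}^{(P)}(\mathcal{A},\mathscr{B}(\mathcal{H}))$.
   Context: $\mathscr{B}(\mathcal{H})$ is the algebra of bounded linear operators on $\mathcal{H}$; $1$ is the unit of $\mathcal{A}$. ''CP'' means completely positive (linear). For $T\in\mathscr{B}(\mathcal{H})$, $\mathrm{Ad}_T(X):=T^*XT$. For a positive operator $P$, $\mathrm{CP}^{(P)}(\mathcal{A},\mathscr{B}(\mathcal{H}))$ is the set of all CP maps $\Phi:\mathcal{A}\to\mathscr{B}(\mathcal{H})$ with $\Phi(1)=P$. A map $\Phi\in\mathrm{CP}^{(P)}(\mathcal{A},\mathscr{B}(\mathcal{H}))$ is a $P$-$C^*$-extreme point of this set if whenever $\Phi=\sum_{j=1}^n\mathrm{Ad}_{T_j}\circ\Phi_j$ with $n\ge 1$, $\Phi_j\in\mathrm{CP}^{(P)}(\mathcal{A},\mathscr{B}(\mathcal{H}))$ and $T_j\in\mathscr{B}(\mathcal{H})$ invertible with $\sum_{j=1}^nT_j^*PT_j=P$, there exist invertible $S_j\in\mathscr{B}(\mathcal{H})$ such that $\Phi_j=\mathrm{Ad}_{S_j}\circ\Phi$ for all $1\leq j\leq n$. Linear extreme points are extreme points in the usual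 convexity sense. *)

(* Defs.v *)
From HB Require Import structures.
From mathcomp Require Import all_boot all_order all_algebra.
From mathcomp Require Import complex.
From mathcomp Require Import ring.
From mathcomp Require Import boolp classical_sets functions reals.
From mathcomp Require Import topology normedtype.

Set Implicit Arguments.
Unset Strict Implicit.
Unset Printing Implicit Defensive.

Import Order.TTheory GRing.Theory Num.Theory.
Import numFieldNormedType.Exports.

Local Open Scope classical_set_scope.
Local Open Scope ring_scope.

(* Unital complex C*-algebras; the zero algebra is allowed.  This is a record,
   with the ring structure installed separately below, because Hierarchy-Builder
   rejects a structure joining rings and normed modules above [numDomainType]. *)
Record cstarAlgType (R : realType) := CstarAlgType {
  cstar_module : completeNormedModType R[i];
  cstar_one : cstar_module;
  cstar_mul : cstar_module -> cstar_module -> cstar_module;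
  cstar_star : cstar_module -> cstar_module;
  cstar_mulA : associative cstar_mul;
  cstar_mul1l : left_id cstar_one cstar_mul;
  cstar_mul1r : right_id cstar_one cstar_mul;
  cstar_mulDl : left_distributive cstar_mul +%R;
  cstar_mulDr : right_distributive cstar_mul +%R;
  cstar_scaleAl : forall (c : R[i]) a b,
    c *: cstar_mul a b = cstar_mul (c *: a) b;
  cstar_scaleAr : forall (c : R[i]) a b,
    c *: cstar_mul a b = cstar_mul a (c *: b);
  cstar_normM : forall a b, `|cstar_mul a b| <= `|a| * `|b|;
  cstar_starK : involutive cstar_star;
  cstar_starD : {morph cstar_star : a b / a + b};
  cstar_starZ : forall (c : R[i]) a, cstar_star (c *: a) = c^* *: cstar_star a;
  cstar_starM : forall a b,
    cstar_star (cstar_mul a b) = cstar_mul (cstar_star b) (cstar_star a);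
  cstar_norm : forall a, `|cstar_mul (cstar_star a) a| = `|a| ^+ 2
}.

Definition cstar_sort (R : realType) (A : cstarAlgType R) : Type :=
  cstar_module A.
Coercion cstar_sort : cstarAlgType >-> Sortclass.

Section CstarAlgebra.
Variables (R : realType) (A : cstarAlgType R).

HB.instance Definition _ :=
  CompleteNormedModule.copy (cstar_sort A) (cstar_module A).

HB.instance Definition _ := GRing.Zmodule_isPzRing.Build (cstar_sort A)
  (@cstar_mulA R A) (@cstar_mul1l R A) (@cstar_mul1r R A)
  (@cstar_mulDl R A) (@cstar_mulDr R A).

Definition star (a : A) : A := cstar_star a.

End CstarAlgebra.

Section PositiveMatrices.
Variables (R : realType) (A : cstarAlgType R).

Definition mxstar m n (M : 'M[A]_(m, n)) : 'M[A]_(n, m) :=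
  map_mx (@star R A) M^T.

(* The positive elements of the C*-algebra of k x k matrices over A. *)
Definition mxpositive k (M : 'M[A]_k) : Prop :=
  exists N : 'M[A]_k, M = mxstar N *m N.

End PositiveMatrices.

(* A finite-dimensional complex Hilbert space is a [vectType R[i]] with a
   positive definite hermitian form [dot], linear in the first variable and
   conjugate-linear in the second; the bounded operators on it are all of
   ['End(H)]. *)
Section Operators.
Variables (R : realType) (H : vectType R[i]) (dot : {dot H for Num.conj}).

Definition is_adjoint (T S : 'End(H)) : Prop :=
  forall x y : H, dot (T x) y = dot x (S y).

Definition adjoint (T : 'End(H)) : 'End(H) := xget 0 (is_adjoint T).

Definition Ad (T X : 'End(H)) : 'End(H) := (adjoint T \o (X \o T))%VF.

Definition invertible (T : 'End(H)) : Prop :=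
  exists S : 'End(H), (S \o T)%VF = \1%VF /\ (T \o S)%VF = \1%VF.

Definition positive_op (P : 'End(H)) : Prop := forall x : H, 0 <= dot (P x) x.

(* Positivity of a k x k matrix of operators, as an operator on H^k. *)
Definition positive_opmx k (M : 'M['End(H)]_k) : Prop :=
  forall x : 'I_k -> H, 0 <= \sum_(i < k) \sum_(j < k) dot (M i j (x j)) (x i).

Lemma adjoint_unique (T S S' : 'End(H)) :
  is_adjoint T S -> is_adjoint T S' -> S = S'.
Proof.
move=> hS hS'; apply/lfunP => y; apply/eqP; rewrite -subr_eq0.
by rewrite -(dnorm_eq0 dot) linearBr /= -hS -hS' subrr.
Qed.

(* Orthogonal projection provides Riesz representatives. *)
Lemma riesz (f : {linear H -> R[i]^o}) : exists w : H, forall x, f x = dot x w.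
Proof.
have [f0|] := pselect (forall x, f x = 0).
  by exists 0 => x; rewrite f0 linear0r.
move=> /existsNP [x0 /eqP fx0].
have [X kX [Y [xE _ /orthoPl oY]]] :=
  orthogonal_split dot (vbasis (lker (linfun f))) x0.
have kerE v : f v = 0 -> dot Y v = 0.
  move=> fv; have : v \in <<vbasis (lker (linfun f))>>%VS.
    by rewrite (span_basis (vbasisP _)) memv_ker lfunE /= fv.
  move=> vV; apply: (span_orthogonal (S1 := [:: Y]) _ _ vV).
    by apply/orthoPl.
  by rewrite memv_span1.
have fX : f X = 0.
  move: kX; rewrite (span_basis (vbasisP _)) memv_ker lfunE /=.
  by move/eqP.
have fY : f Y != 0 by move: fx0; rewrite xE linearD /= fX add0r.
have Y0 : Y != 0 by apply: contraNneq fY => ->; rewrite linear0.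
have dY : dot Y Y != 0 by rewrite dnorm_eq0.
exists ((f Y / dot Y Y)^* *: Y) => x.
rewrite linearZr_LR /= conjCK.
have := kerE (x - (f x / f Y) *: Y).
rewrite linearB linearZ /= -[_ *: _]/(_ * _) divfK // subrr => /(_ erefl).
rewrite linearBr linearZr_LR /= => /eqP; rewrite subr_eq0 => /eqP YxE.
have -> : dot x Y = f x / f Y * dot Y Y.
  rewrite hermC /= expr0 mul1r YxE rmorphM /= conjCK; congr (_ * _).
  by rewrite geC0_conj // dnorm_ge0.
by field; rewrite fY dY.
Qed.

Lemma adjointP (T : 'End(H)) : is_adjoint T (adjoint T).
Proof.
suff [S hS] : exists S, is_adjoint T S by exact: (@xgetI _ 0 (is_adjoint T) S).
have h y : exists w, forall x, dot (T x) y = dot x w.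
  have lin : linear (fun x : H => dot (T x) y : R[i]^o).
    by move=> a u v; rewrite linearP linearDl /= linearZl_LR.
  exact: (riesz (HB.pack (fun x : H => dot (T x) y : R[i]^o)
    (GRing.isLinear.Build _ _ _ _ (fun x : H => dot (T x) y : R[i]^o) lin))).
have [g gP] := choice h.
have dot_inj u v : (forall x, dot x u = dot x v) -> u = v.
  move=> e; apply/eqP; rewrite -subr_eq0 -(dnorm_eq0 dot) linearBr /=.
  by rewrite e subrr.
have lin : linear g.
  move=> a u v; apply: dot_inj => x.
  by rewrite -gP !linearDr /= !linearZr_LR /= !gP.
pose gl : {linear H -> H} := HB.pack g (GRing.isLinear.Build _ _ _ _ g lin).
by exists (linfun gl) => x y; rewrite lfunE /= gP.
Qed.

End Operators.

Section CompletelyPositive.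
Variables (R : realType) (A : cstarAlgType R).
Variables (H : vectType R[i]) (dot : {dot H for Num.conj}).

Definition completely_positive (Phi : A -> 'End(H)) : Prop :=
  linear Phi /\
  forall (k : nat) (M : 'M[A]_k),
    mxpositive M -> positive_opmx dot (map_mx Phi M).

Definition CP (P : 'End(H)) : set (A -> 'End(H)) :=
  [set Phi | completely_positive Phi /\ Phi 1 = P].

Definition Cstar_extreme (P : 'End(H)) (Phi : A -> 'End(H)) : Prop :=
  CP P Phi /\
  forall (n : nat) (T : 'I_n -> 'End(H)) (Psi : 'I_n -> A -> 'End(H)),
    (1 <= n)%N ->
    (forall j, CP P (Psi j)) ->
    (forall j, invertible (T j)) ->
    \sum_(j < n) Ad dot (T j) P = P ->
    (forall a, Phi a = \sum_(j < n) Ad dot (T j) (Psi j a)) ->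
    exists S : 'I_n -> 'End(H),
      (forall j, invertible (S j)) /\
      (forall j a, Psi j a = Ad dot (S j) (Phi a)).

End CompletelyPositive.

(* In a [numFieldType], such as [R[i]], [0 < t < 1] forces [t] to be real. *)
Definition linear_extreme (K : numFieldType) (V : lmodType K)
    (C : set V) (x : V) : Prop :=
  C x /\
  forall (y z : V) (t : K), C y -> C z -> 0 < t < 1 ->
    x = t *: y + (1 - t) *: z -> y = x /\ z = x.

(* Main.v *)
(* Taking T_1 = sqrt t and T_2 = sqrt (1 - t), C*-extremality turns a convex
   decomposition Phi = t Y + (1 - t) Z into Y = Ad_{S_1} o Phi and
   Z = Ad_{S_2} o Phi, and evaluating at 1 gives S_j^* P S_j = P.  Complete
   positivity makes the sesquilinear form of every Phi a vanish on the kernel of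
   P, so it descends to a form on H / ker P, on which P induces an inner product
   and the S_j act as unitaries.  Hence Phi a, Y a and Z a have the same
   Hilbert-Schmidt norm relative to P, and strict convexity of that norm forces
   Y a = Z a.  Everything is computed with Gram matrices in an arbitrary basis
   of H; the inner product on H / ker P is handled through a matrix K such that
   K K^* is a generalized inverse of the Gram matrix of P. *)
Require Import Defs.
From mathcomp Require Import all_boot all_order all_algebra.
From mathcomp Require Import complex ring.
From mathcomp Require Import boolp classical_sets functions reals.

Set Implicit Arguments.
Unset Strict Implicit.
Unset Printing Implicit Defensive.

Import Order.TTheory GRing.Theory Num.Theory.

Local Open Scope ring_scope.
Local Open Scope sesquilinear_scope.

(** * Hilbert-Schmidt norms weighted by a generalized inverse *)

Section ConjugateTranspose.
Variable C : numClosedFieldType.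

Lemma trmxC_mul m n p (A : 'M[C]_(m, n)) (B : 'M[C]_(n, p)) :
  (A *m B)^t* = B^t* *m A^t*.
Proof. by rewrite trmx_mul map_mxM. Qed.

Lemma trmxCD m n (A B : 'M[C]_(m, n)) : (A + B)^t* = A^t* + B^t*.
Proof. by rewrite linearD map_mxD. Qed.

Lemma trmxCB m n (A B : 'M[C]_(m, n)) : (A - B)^t* = A^t* - B^t*.
Proof. by rewrite linearB map_mxB. Qed.

Lemma trmxCZ m n c (A : 'M[C]_(m, n)) : (c *: A)^t* = c^* *: A^t*.
Proof. by rewrite linearZ map_mxZ. Qed.

Lemma mxtrace_mulmx_trmxC_eq0 m n (X : 'M[C]_(m, n)) :
  \tr (X *m X^t*) = 0 -> X = 0.
Proof.
have E : \tr (X *m X^t*) = \sum_i \sum_j `|X i j| ^+ 2.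
  apply: eq_bigr => i _; rewrite mxE.
  by apply: eq_bigr => j _; rewrite !mxE normCK.
move/eqP; rewrite E psumr_eq0 => [/allP h|i _]; last first.
  by apply: sumr_ge0 => j _; apply: exprn_ge0.
apply/matrixP => i j; rewrite mxE.
have := h i (mem_index_enum i); rewrite psumr_eq0 => [/allP h'|k _]; last first.
  exact: exprn_ge0.
have := h' j (mem_index_enum j).
by rewrite /= sqrf_eq0 normr_eq0 => /eqP.
Qed.

(* Strict convexity of the Hilbert-Schmidt norm. *)
Lemma eq_of_mxtrace_convex m n (X Y Z : 'M[C]_(m, n)) (t : C) :
  0 < t < 1 -> X = t *: Y + (1 - t) *: Z ->
  \tr (Y *m Y^t*) = \tr (X *m X^t*) -> \tr (Z *m Z^t*) = \tr (X *m X^t*) ->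
  Y = Z.
Proof.
move=> /andP[t0 t1] XE NY NZ.
have [D YE] : exists D, Y = Z + D by exists (Y - Z); rewrite addrC subrK.
have {}XE : X = Z + t *: D.
  by rewrite XE YE scalerDr scalerBl scale1r addrC addrA subrK.
have tC : t^* = t by rewrite geC0_conj // ltW.
move: NY NZ; rewrite XE YE !trmxCD !trmxCZ tC.
rewrite !mulmxDl !mulmxDr -!scalemxAl -!scalemxAr !mxtraceD !mxtraceZ.
set a := \tr (Z *m Z^t*); set b := \tr (Z *m D^t*).
set c := \tr (D *m Z^t*); set d := \tr (D *m D^t*).
move=> e1 e2.
(* This is [t |Y|^2 + (1 - t) |Z|^2 - |X|^2], the defect in the convexity inequality, which vanishes
   when the three norms agree. *)
have d0 : t * (1 - t) * d = 0.
  have {}e1 : a + b + (c + d) = a by rewrite e1 -e2.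
  have -> : t * (1 - t) * d = t * ((a + b + (c + d)) - a)
      + (a - (a + t * b + (t * c + t * (t * d)))) by ring.
  by rewrite e1 -e2 !subrr mulr0 addr0.
have /mxtrace_mulmx_trmxC_eq0 : d = 0.
  apply/eqP; move/eqP: d0; rewrite !mulf_eq0 (gt_eqF t0) subr_eq0.
  by rewrite (gt_eqF t1).
by move=> D0; rewrite D0 addr0.
Qed.

(** By the spectral theorem [M = U^* d U] with [d >= 0]; taking [K = U^* d^(-1/2)] makes [K K^*] the
    Moore-Penrose inverse of [M]. *)
Lemma psd_factor_pinv n (M : 'M[C]_n) : M^t* = M ->
  (forall x : 'rV_n, 0 <= (x *m M *m x^t*) 0 0) ->
  exists K : 'M_n, M *m (K *m K^t*) *m M = M.
Proof.
move=> hM pM; pose U := spectralmx M; pose d := spectral_diag M.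
have Uu : U \is unitarymx by exact: spectral_unitarymx.
have ME : M = U^t* *m diag_mx d *m U.
  have /orthomx_spectralP : M \is normalmx by apply/normalmxP; rewrite hM.
  by rewrite invmx_unitary.
have UU : U *m U^t* = 1%:M by apply/unitarymxP.
have d_ge0 i : 0 <= d 0 i.
  have := pM (row i U); rewrite -row_mul ME !mulmxA UU mul1mx.
  have -> : (row i (diag_mx d *m U) *m (row i U)^t*) 0 0
    = (diag_mx d *m U *m U^t*) i i.
    by rewrite !mxE; apply: eq_bigr => j _; rewrite !mxE.
  by rewrite -mulmxA UU mulmx1 mxE eqxx.
(* Inversion sends 0 to 0, so null eigenvalues of [M] stay null in [K K^*]. *)
pose r := \row_i (sqrtC (d 0 i))^-1.
exists (U^t* *m diag_mx r).
have rr : diag_mx r *m (diag_mx r)^t* = diag_mx (\row_i (d 0 i)^-1).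
  rewrite tr_diag_mx map_diag_mx mulmx_diag; congr diag_mx.
  apply/rowP => i; rewrite !mxE fmorphV /= geC0_conj ?sqrtC_ge0 //.
  by rewrite -invfM -expr2 sqrtCK.
have UUm (X Y : 'M[C]_n) :
    (U^t* *m X *m U) *m (U^t* *m Y *m U) = U^t* *m (X *m Y) *m U.
  by rewrite !mulmxA -[_ *m U *m U^t*]mulmxA UU mulmx1.
have -> : U^t* *m diag_mx r *m (U^t* *m diag_mx r)^t*
    = U^t* *m diag_mx (\row_i (d 0 i)^-1) *m U.
  by rewrite trmxC_mul trmxCK mulmxA -(mulmxA (U^t*)) rr.
rewrite ME !UUm; congr (_ *m _ *m _).
rewrite !mulmx_diag; congr diag_mx; apply/rowP => i; rewrite !mxE.
by have [->|d0] := eqVneq (d 0 i) 0; [rewrite !mulr0 | rewrite divff ?mul1r].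
Qed.

(** By cyclicity of the trace, the norm of the compression sees [K] only through [Q]. *)
Lemma mxtrace_mul_trmxC_weighted m n (B : 'M[C]_m) (K : 'M[C]_(m, n)) :
  let X := K^t* *m B *m K in let Q := K *m K^t* in
  \tr (X *m X^t*) = \tr (B *m Q *m B^t* *m Q).
Proof.
rewrite /= !trmxC_mul trmxCK -!mulmxA mxtrace_mulC.
by rewrite !mulmxA.
Qed.

(** [1 - M Q] annihilates [M] from the left, hence also [G]; its adjoint [1 - Q M] annihilates [G]
    from the right. *)
Lemma weighted_factor n (M Q G : 'M[C]_n) :
    M^t* = M -> Q^t* = Q -> M *m Q *m M = M ->
    (forall W : 'M_n, W *m M = 0 -> W *m G = 0 /\ G *m W^t* = 0) ->
  G = M *m Q *m G /\ G = G *m Q *m M.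
Proof.
move=> hM hQ MQM ker.
have WM : (1%:M - M *m Q) *m M = 0 by rewrite mulmxBl mul1mx MQM subrr.
have [W1 W2] := ker _ WM; split; apply/eqP.
  by rewrite -subr_eq0 -{1}[G]mul1mx -mulmxBl W1.
rewrite -subr_eq0 -{1}[G]mulmx1 -mulmxA -mulmxBr -[Q *m M]trmxCK.
by rewrite trmxC_mul hM hQ -[X in X - _]trmxCK trmx1 map_mx1 -trmxCB W2.
Qed.

(** [Q' = s^* Q s] is another generalized inverse of [M], and [B Q B^*] and [B^* Q B] do not depend
    on which one is used, because [B] factors through [M] on both sides. *)
Lemma mxtrace_weighted_invariant n (M Q B s : 'M[C]_n) :
    M^t* = M -> Q^t* = Q -> M *m Q *m M = M ->
    B = M *m Q *m B -> B = B *m Q *m M ->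
    s \in unitmx -> s *m M *m s^t* = M ->
  let B' := s *m B *m s^t* in
  \tr (B' *m Q *m B'^t* *m Q) = \tr (B *m Q *m B^t* *m Q).
Proof.
move=> hM hQ MQM BE1 BE2 su sM B'.
pose Q' := s^t* *m Q *m s.
have su' : s^t* \in unitmx by rewrite map_unitmx unitmx_tr.
have sM1 : s *m M = M *m invmx (s^t*) by rewrite -[in RHS]sM mulmxK.
have sM2 : M *m s^t* = invmx s *m M by rewrite -[in RHS]sM -mulmxA mulKmx.
have MQ'M : M *m Q' *m M = M.
  rewrite /Q' !mulmxA sM2 -[_ *m s *m M]mulmxA sM1 mulmxA.
  rewrite -[invmx s *m M *m Q]mulmxA -[invmx s *m _ *m M]mulmxA MQM.
  by rewrite -mulmxA -sM1 mulKmx.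
have BE1' : B^t* = B^t* *m Q *m M.
  by rewrite [in LHS]BE1 !trmxC_mul hM hQ mulmxA.
have BE2' : B^t* = M *m Q *m B^t*.
  by rewrite [in LHS]BE2 !trmxC_mul hM hQ mulmxA.
(* Writing [B = B Q M] and [B^* = M Q B^*] leaves [Q'] only inside [M Q' M], which is [M]. *)
have e1 : B *m Q' *m B^t* = B *m Q *m B^t*.
  transitivity (B *m Q *m (M *m Q' *m M) *m (Q *m B^t*)).
    by rewrite !mulmxA -BE2 -!mulmxA (mulmxA M Q) -BE2'.
  by rewrite MQ'M !mulmxA -BE2.
have e2 : B^t* *m Q' *m B = B^t* *m Q *m B.
  transitivity (B^t* *m Q *m (M *m Q' *m M) *m (Q *m B)).
    by rewrite !mulmxA -BE1' -!mulmxA (mulmxA M Q) -BE1.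
  by rewrite MQ'M !mulmxA -BE1'.
transitivity (\tr (B *m Q' *m B^t* *m Q')).
  rewrite /B' !trmxC_mul trmxCK -!mulmxA mxtrace_mulC -!mulmxA.
  by rewrite /Q' !mulmxA.
rewrite e1 -(mulmxA (B *m Q)) mxtrace_mulC mulmxA e2.
by rewrite -(mulmxA (B^t* *m Q)) mxtrace_mulC mulmxA.
Qed.

(** Both congruences preserve [M], so the compressions by [K] of [G] and of its two congruent copies
    have the same Hilbert-Schmidt norm. Strict convexity identifies the compressions of the copies,
    and a form vanishing on the kernel of [M] is recovered from its compression. *)
Lemma convex_congruence_rigid n (M G s1 s2 : 'M[C]_n) (t : C) :
    M^t* = M -> (forall x : 'rV_n, 0 <= (x *m M *m x^t*) 0 0) ->
    (forall W : 'M_n, W *m M = 0 -> W *m G = 0 /\ G *m W^t* = 0) ->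
    s1 \in unitmx -> s2 \in unitmx ->
    s1 *m M *m s1^t* = M -> s2 *m M *m s2^t* = M -> 0 < t < 1 ->
    G = t *: (s1 *m G *m s1^t*) + (1 - t) *: (s2 *m G *m s2^t*) ->
  s1 *m G *m s1^t* = s2 *m G *m s2^t*.
Proof.
move=> hM pM kerG s1u s2u s1M s2M t01 GE.
have [K MQM] := psd_factor_pinv hM pM.
have hQ : (K *m K^t*)^t* = K *m K^t* by rewrite trmxC_mul trmxCK.
pose N X := K^t* *m X *m K.
have [e1 e2] := weighted_factor hM hQ MQM kerG.
have N_cong s : s \in unitmx -> s *m M *m s^t* = M ->
    \tr (N (s *m G *m s^t*) *m (N (s *m G *m s^t*))^t*)
    = \tr (N G *m (N G)^t*).
  move=> su sM; rewrite [LHS]mxtrace_mul_trmxC_weighted.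
  rewrite [RHS]mxtrace_mul_trmxC_weighted.
  exact: mxtrace_weighted_invariant hM hQ MQM e1 e2 su sM.
have N_recover s : s \in unitmx -> s *m M *m s^t* = M ->
    s *m G *m s^t* = M *m K *m N (s *m G *m s^t*) *m K^t* *m M.
  move=> su sM.
  have su' : s^t* \in unitmx by rewrite map_unitmx unitmx_tr.
  (* [W s M s^* = W M = 0] with [s^*] invertible, so [s] carries the kernel of [M] to itself. *)
  have ker (W : 'M_n) : W *m M = 0 ->
      W *m (s *m G *m s^t*) = 0 /\ s *m G *m s^t* *m W^t* = 0.
    move=> WM; have WsM : W *m s *m M = 0.
      by apply: (can_inj (mulmxK su')); rewrite mul0mx -!mulmxA (mulmxA s) sM.
    have [g1 g2] := kerG _ WsM.
    by rewrite -!mulmxA -trmxC_mul g2 mulmx0 !mulmxA g1 mul0mx.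
  have [f1 f2] := weighted_factor hM hQ MQM ker.
  set X := s *m G *m s^t* in f1 f2 *.
  by rewrite [LHS]f1 {1}f2 /N !mulmxA.
rewrite N_recover // [RHS]N_recover //; congr (_ *m _ *m _ *m _).
apply: (eq_of_mxtrace_convex t01 (X := N G)); rewrite ?N_cong //.
by rewrite /N [in LHS]GE mulmxDr mulmxDl -!scalemxAr -!scalemxAl.
Qed.

End ConjugateTranspose.

(** * Operators as sesquilinear forms, in coordinates *)

Section Gram.
Variables (R : realType) (H : vectType R[i]) (dot : {dot H for Num.conj}).

Let e := vbasis (@fullv _ H).

(** Recording the form rather than the operator allows a basis that is not orthonormal and turns
    [Ad] into a congruence. *)
Definition gram (F : 'End(H)) : 'M[R[i]]_(\dim {:H}) :=
  \matrix_(i, j) dot (F e`_i) e`_j.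

Definition vec_of_row (x : 'rV[R[i]]_(\dim {:H})) : H := \sum_i x 0 i *: e`_i.

(** Acts on coordinate rows from the right, so composition reverses products. *)
Definition mx_of_end (S : 'End(H)) : 'M[R[i]]_(\dim {:H}) :=
  \matrix_(i, j) coord e j (S e`_i).

Lemma vec_of_coord v : vec_of_row (\row_i coord e i v) = v.
Proof.
rewrite [RHS](coord_vbasis (memvf v)).
by apply: eq_bigr => i _; rewrite mxE.
Qed.

Lemma end_basisE (S : 'End(H)) (i : 'I_(\dim {:H})) :
  S e`_i = vec_of_row (row i (mx_of_end S)).
Proof.
by rewrite -[LHS]vec_of_coord; congr vec_of_row; apply/rowP => j; rewrite !mxE.
Qed.

Lemma dot_vec_of_row (F : 'End(H)) x y :
  dot (F (vec_of_row x)) (vec_of_row y) = (x *m gram F *m y^t*) 0 0.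
Proof.
rewrite linear_sumr mxE /=; apply: eq_bigr => j _.
rewrite linearZr_LR /= linear_sum linear_sumlz /= !mxE mulrC; congr (_ * _).
by apply: eq_bigr => i _; rewrite linearZ linearZl_LR mxE.
Qed.

Lemma gram_inj : injective gram.
Proof.
move=> F G FG; apply/lfunP => v; apply/eqP; rewrite -subr_eq0.
rewrite -(dnorm_eq0 dot) linearBl /=.
have E u : dot (F v) u = dot (G v) u.
  by rewrite -[v]vec_of_coord -[u]vec_of_coord !dot_vec_of_row FG.
by rewrite E subrr.
Qed.

Lemma gramD F G : gram (F + G) = gram F + gram G.
Proof. by apply/matrixP => i j; rewrite !mxE lfunE /= linearDl. Qed.

Lemma gramZ c F : gram (c *: F) = c *: gram F.
Proof. by apply/matrixP => i j; rewrite !mxE lfunE /= linearZl_LR. Qed.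

Lemma dot_adjointl (T : 'End(H)) x y : dot (adjoint dot T x) y = dot x (T y).
Proof.
by rewrite hermC /= expr0 mul1r -(adjointP dot T) [RHS]hermC /= expr0 mul1r.
Qed.

Lemma gram_Ad (S F : 'End(H)) :
  gram (Ad dot S F) = mx_of_end S *m gram F *m (mx_of_end S)^t*.
Proof.
apply/matrixP => i j; rewrite mxE /Ad !lfunE /= lfunE /= dot_adjointl.
rewrite !end_basisE dot_vec_of_row -row_mul !mxE.
by apply: eq_bigr => k _; rewrite !mxE.
Qed.

Lemma mx_of_end_comp (S T : 'End(H)) :
  mx_of_end (S \o T)%VF = mx_of_end T *m mx_of_end S.
Proof.
apply/matrixP => i j; rewrite !mxE lfunE /= end_basisE /vec_of_row !linear_sum.
by apply: eq_bigr => k _; rewrite !linearZ /= !mxE.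
Qed.

Lemma mx_of_end1 : mx_of_end \1%VF = 1%:M.
Proof.
apply/matrixP => i j; rewrite !mxE id_lfunE coord_free 1?eq_sym //.
exact: basis_free (vbasisP _).
Qed.

Lemma invertible_mx_of_end S : invertible S -> mx_of_end S \in unitmx.
Proof.
move=> [T [TS _]]; have := mx_of_end_comp T S; rewrite TS mx_of_end1.
by move=> /esym/mulmx1_unit[].
Qed.

Lemma Ad_scale (c : R[i]) (X : 'End(H)) :
  Ad dot (c *: \1%VF) X = `|c| ^+ 2 *: X.
Proof.
apply: gram_inj; rewrite gramZ; apply/matrixP => i j.
rewrite !mxE /Ad !comp_lfunE dot_adjointl /= !scale_lfunE !id_lfunE.
by rewrite linearZr_LR linearZ /= linearZl_LR /= mulrA [_^* * _]mulrC normCK.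
Qed.

Lemma invertible_scale (c : R[i]) : c != 0 -> invertible (c *: \1%VF : 'End(H)).
Proof.
move=> c0; exists (c^-1 *: \1%VF).
rewrite -!comp_lfunZl -!comp_lfunZr !comp_lfun1l !scalerA mulVf //.
by rewrite mulfV // scale1r.
Qed.

(** Polarization: [dot (P v) v] is real at [v = x + c y], and the cases [c = 1] and [c = 'i]
    together make [dot (P y) x] the conjugate of [dot (P x) y]. *)
Lemma positive_gram_herm (P : 'End(H)) :
  positive_op dot P -> (gram P)^t* = gram P.
Proof.
move=> hP; apply/matrixP => i j; rewrite !mxE.
set x := e`_j; set y := e`_i.
have real v : (dot (P v) v)^* = dot (P v) v by rewrite geC0_conj.
set a := dot (P x) y; set b := dot (P y) x.
have h c : c * a^* + c^* * b^* = c^* * a + c * b.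
  have dE : dot (P (x + c *: y)) (x + c *: y)
      = dot (P x) x + c * c^* * dot (P y) y + (c^* * a + c * b).
    have -> : P (x + c *: y) = P x + c *: P y by rewrite linearD linearZ.
    rewrite linearDl /= !linearDr /= !linearZl_LR /= !linearZr_LR /= -/a -/b.
    by ring.
  have := real (x + c *: y); rewrite dE !rmorphD /= !rmorphM /= !conjCK !real.
  by rewrite [c^* * c]mulrC => /addrI.
have h1 : a^* + b^* = a + b by have := h 1; rewrite conjC1 !mul1r.
have h2 : a^* - b^* = b - a.
  apply: (mulfI (neq0Ci (R[i]))); have := h 'i; rewrite conjCi => hi.
  by rewrite mulrBr -mulNr hi; ring.
have two0 : 2 != 0 :> R[i] by rewrite pnatr_eq0.
apply: (mulfI two0); transitivity ((a^* + b^*) + (a^* - b^*)); first by ring.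
by rewrite h1 h2; ring.
Qed.

End Gram.

(** * The involution of [A] and a positive 2 by 2 matrix *)

Section Star.
Variables (R : realType) (A : cstarAlgType R).

Lemma starK : involutive (@star R A). Proof. exact: cstar_starK. Qed.

Lemma star0 : star (0 : A) = 0.
Proof.
have /eqP : star (0 + 0 : A) = star 0 + star 0 by exact: cstar_starD.
by rewrite addr0 -[X in X == _]addr0 (inj_eq (addrI _)) => /eqP.
Qed.

Lemma star1 : star (1 : A) = 1.
Proof.
have h (a : A) : star 1 * a = a.
  have : star (star a * 1) = star 1 * star (star a) by exact: cstar_starM.
  by rewrite mulr1 !starK.
by rewrite -[LHS]mulr1 h.
Qed.

(** The factor has first row [1, a] and second row zero. Complete positivity on this matrix yields a
    Schwarz-type inequality. *)
Lemma mxpositive_row (a : A) : mxpositive (\matrix_(i < 2, j < 2)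
  (if i == 0 then if j == 0 then 1 else a
   else if j == 0 then star a else star a * a)).
Proof.
exists (\matrix_(i < 2, j < 2) (if i == 0 then if j == 0 then 1 else a else 0)).
apply/matrixP => i j; rewrite mxE [RHS]mxE big_ord_recl big_ord1 !mxE /=.
rewrite star0 mul0r addr0.
by do 2!case: ifP => _; rewrite ?star1 ?mul1r ?mulr1.
Qed.

End Star.

(** * Vanishing of CP maps on the kernel of [P] *)

Lemma eq0_of_affine_ge0 (C : numFieldType) (z c : C) :
  (forall r, r \is Num.real -> 0 <= r * z + c) -> z = 0.
Proof.
move=> h; have c0 : 0 <= c by have := h 0 (real0 _); rewrite mul0r add0r.
have zr : z \is Num.real.
  rewrite -[z](addrK c) realB ?(ger0_real c0) //.
  by have := h 1 (real1 _); rewrite mul1r => /ger0_real.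
apply/eqP/negPn/negP => z0.
(* At this [r] the affine expression equals -1. *)
have rr : - (c + 1) / z \is Num.real.
  by rewrite realM ?realV ?zr // rpredN rpredD ?real1 ?ger0_real.
by have := h _ rr; rewrite divfK // opprD addrAC addNr add0r ler0N1.
Qed.

Section CPKernel.
Variables (R : realType) (A : cstarAlgType R).
Variables (H : vectType R[i]) (dot : {dot H for Num.conj}).

(* Positivity of the image of the matrix [[1, a], [a^*, a^* a]]. *)
Lemma CP_schwarz (P : 'End(H)) (Phi : A -> 'End(H)) : CP dot P Phi ->
  forall a x y, 0 <= dot (P x) x + dot (Phi a y) x + (dot (Phi (star a) x) y
    + dot (Phi (star a * a) y) y).
Proof.
move=> [[_ pos] <-] a x y.
have := pos _ _ (mxpositive_row a) (fun i => if i == 0 then x else y).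
by rewrite !(big_ord_recl, big_ord0) !mxE /= !addr0.
Qed.

(** Putting [x = r c v] in the inequality of [CP_schwarz] kills the term in [P] and leaves an
    expression affine in the real [r]; its nonnegativity for all [r] forces the slope to vanish. *)
Lemma CP_kernel (P : 'End(H)) (Phi : A -> 'End(H)) v : CP dot P Phi ->
  dot (P v) v = 0 -> forall a y, dot (Phi a y) v = 0 /\ dot (Phi a v) y = 0.
Proof.
move=> PhiP Pv.
have key a y c : c^* * dot (Phi a y) v + c * dot (Phi (star a) v) y = 0.
  apply: (@eq0_of_affine_ge0 _ _ (dot (Phi (star a * a) y) y)) => r rr.
  have := CP_schwarz PhiP a ((r * c) *: v) y.
  rewrite [P _]linearZ [Phi (star a) _]linearZ /= linearZl_LR linearZr_LR /=.
  rewrite linearZl_LR linearZr_LR /= Pv !mulr0 add0r rmorphM /= (CrealP rr).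
  by rewrite addrA mulrDr !mulrA.
have ker a y : dot (Phi a y) v = 0 /\ dot (Phi (star a) v) y = 0.
  (* [c = 1] makes the two values opposite, [c = 'i] makes them equal. *)
  have := key a y 1; rewrite conjC1 !mul1r => /eqP; rewrite addr_eq0 => /eqP h1.
  have := key a y 'i; rewrite conjCi h1 mulrNN -mulr2n => /eqP.
  rewrite -mulrnAr mulf_eq0 (negPf (neq0Ci _)) mulrn_eq0 /= => /eqP h2.
  by rewrite h2 oppr0 in h1 *.
move=> a y; split; first by have [] := ker a y.
by have [_] := ker (star a) y; rewrite starK.
Qed.

(** Each row of [W] holds the coordinates of a vector [v] with [dot (P v) v = 0], to which
    [CP_kernel] applies. *)
Lemma CP_gram_ker (P : 'End(H)) (Phi : A -> 'End(H)) m
    (W : 'M[R[i]]_(m, \dim {:H})) a : CP dot P Phi ->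
  W *m gram dot P = 0 ->
  W *m gram dot (Phi a) = 0 /\ gram dot (Phi a) *m W^t* = 0.
Proof.
move=> PhiP WM; set G := gram dot (Phi a).
have ker i (y : 'rV_(\dim {:H})) :
    (row i W *m G *m y^t*) 0 0 = 0 /\ (y *m G *m (row i W)^t*) 0 0 = 0.
  rewrite -!dot_vec_of_row.
  have Pv : dot (P (vec_of_row (row i W))) (vec_of_row (row i W)) = 0.
    by rewrite dot_vec_of_row -row_mul WM row0 mul0mx mxE.
  by have [] := CP_kernel PhiP Pv a (vec_of_row y).
have rowE k l n (X : 'M[R[i]]_(k, n)) (Y : 'M_(l, n)) i j :
    (X *m Y^t*) i j = (row i X *m (row j Y)^t*) 0 0.
  by rewrite !mxE; apply: eq_bigr => p _; rewrite !mxE.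
split.
  apply: mxtrace_mulmx_trmxC_eq0; apply: big1 => i _.
  by rewrite rowE {1}row_mul; exact: (ker i _).1.
rewrite -[LHS]trmxCK; set V := (G *m W^t*)^t*.
suff -> : V = 0 by rewrite trmx0 map_mx0.
apply: mxtrace_mulmx_trmxC_eq0; apply: big1 => i _.
by rewrite {2}/V trmxCK mulmxA rowE row_mul; exact: (ker i _).2.
Qed.

End CPKernel.

(** * From C*-extremality to congruences of Gram matrices *)

Theorem proposition3p21 (R : realType) (A : cstarAlgType R)
    (H : vectType R[i]) (dot : {dot H for Num.conj})
    (P : 'End(H)) (hP : positive_op dot P) (Phi : A -> 'End(H)) :
  Cstar_extreme dot P Phi -> linear_extreme (CP dot P) Phi.
Proof.
move=> [PhiP ext]; split=> // Y Z t YP ZP t01 PhiE.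
have /andP[t0 t1] := t01.
have t1' : 0 < 1 - t by rewrite subr_gt0.
have PhiEa a : Phi a = t *: Y a + (1 - t) *: Z a by rewrite PhiE.
have sq (c : R[i]) : 0 < c -> `|sqrtC c| ^+ 2 = c.
  by move=> c0; rewrite ger0_norm ?sqrtCK // sqrtC_ge0 ltW.
have sq0 (c : R[i]) : 0 < c -> sqrtC c != 0.
  by move=> c0; rewrite sqrtC_eq0 gt_eqF.
have [] := ext 2 (fun j => sqrtC (if j == 0 then t else 1 - t) *: \1%VF)
                 (fun j => if j == 0 then Y else Z) isT.
- by move=> j; case: ifP.
- by move=> j; apply: invertible_scale; case: ifP => _; apply: sq0.
- rewrite big_ord_recl big_ord1 /= !Ad_scale !sq //.
  by rewrite -scalerDl addrC subrK scale1r.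
- by move=> a; rewrite big_ord_recl big_ord1 /= !Ad_scale !sq.
move=> S [invS SE].
suff YZ : Y = Z.
  have -> : Phi = Z by rewrite PhiE YZ -scalerDl addrC subrK scale1r.
  by [].
have YE a : Y a = Ad dot (S ord0) (Phi a) := SE ord0 a.
have ZE a : Z a = Ad dot (S (lift ord0 ord0)) (Phi a) := SE (lift ord0 ord0) a.
have Phi1 : Phi 1 = P by case: PhiP.
apply/funext => a; apply: (gram_inj (dot := dot)).
rewrite YE ZE !gram_Ad.
(* Here [M] is the Gram matrix of [P], [G] that of [Phi a], and [s1], [s2] are the matrices of the
   two operators [S]. *)
apply: (convex_congruence_rigid (positive_gram_herm hP) _ _ _ _ _ _ t01).
- by move=> x; rewrite -dot_vec_of_row; exact: hP.
- by move=> W WM; exact: CP_gram_ker WM.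
- exact: invertible_mx_of_end.
- exact: invertible_mx_of_end.
(* Evaluation at the unit, where [Phi] and [Y] both equal [P], shows that the congruence preserves
   [M]. *)
- by rewrite -gram_Ad -[in LHS]Phi1 -YE; case: YP => _ ->.
- by rewrite -gram_Ad -[in LHS]Phi1 -ZE; case: ZP => _ ->.
- by rewrite [in LHS]PhiEa YE ZE gramD !gramZ !gram_Ad.
Qed.
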